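(* For every sequence $l=(l_i)_{i\in\mathbb{N}}$ of natural numbers (positive integers), the $l$-Grigorchuk subshift $\Omega(\eta_l)$ is minimal.
   Context: Let $\mathbb{N}=\{1,2,\dots\}$ and $\mathbb{N}_0=\mathbb{N}\cup\{0\}$. For an infinite word $w$ over a finite alphabet, $\Omega(w)$ is the closure (product of discrete topologies) of $\{\sigma^k(w):k\in\mathbb{N}_0\}$, where $\sigma$ is the left-shift. A subshift $Y$ is minimal if for all $y\in Y$ the set $\Omega(y)$ is dense in $Y$. $l$-Grigorchuk subshift: On the alphabet $\{a,x,y,z\}$, for $\beta\in\{x,y,z\}$ let $\tau_\beta$ be the monoid homomorphism (under concatenation) of finite words with $\tau_\beta(a)=a\beta a$, $\tau_\beta(x)=x$, $\tau_\beta(y)=y$, $\tau_\beta(z)=z$. Put $\beta_k=x,y,z$ according as $k\equiv1,2,0\pmod 3$. For $j\in\mathbb{N}_0$ let $N(j)\ge1$ and $q(j)$ be the unique integers with $j=q(j)+\sum_{i=1}^{N(j)-1}l_i$ and $0\le q(j)<l_{N(j)}$, and put $\tau^{(j)}=\tau_{\beta_1}^{l_1}\circ\tau_{\beta_2}^{l_2}\circ\cdots\circ\tau_{\beta_{N(j)-1}}^{l_{N(j)-1}}\circ\tau_{\beta_{N(j)}}^{q(j)}$ (so $\tau^{(0)}$ is the identity). Then $\eta_l$ is the unique infinite word having $\tau^{(j)}(a)$ as a prefix for all $j\in\mathbb{N}_0$, and $\Omega(\eta_l)$ is the $l$-Grigorchuk subshift. *)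

(* Defs.v *)
From HB Require Import structures.
From mathcomp Require Import all_boot.
From mathcomp Require Import boolp classical_sets topology.
From mathcomp Require Import zify.

Set Implicit Arguments.
Unset Strict Implicit.
Unset Printing Implicit Defensive.

Local Open Scope classical_set_scope.

Inductive letter := La | Lx | Ly | Lz.

Definition nat_of_letter (c : letter) : nat :=
  match c with La => 0 | Lx => 1 | Ly => 2 | Lz => 3 end.

Definition letter_of_nat (n : nat) : option letter :=
  match n with
  | 0 => Some La | 1 => Some Lx | 2 => Some Ly | 3 => Some Lz | _ => None
  end.

Lemma nat_of_letterK : pcancel nat_of_letter letter_of_nat.
Proof. by case. Qed.

HB.instance Definition _ := Countable.copy letter (pcan_type nat_of_letterK).

Lemma letter_enumP : Finite.axiom [:: La; Lx; Ly; Lz].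
Proof. by case. Qed.

HB.instance Definition _ := isFinite.Build letter letter_enumP.
HB.instance Definition _ := isPointed.Build letter La.

(* Infinite words are indexed by N_0. *)
Definition word : Type := prod_topology (fun _ : nat => discrete_topology letter).

HB.instance Definition _ := Pointed.on word.
HB.instance Definition _ := Topological.on word.

Definition shift (w : word) : word := fun n => w n.+1.

Definition Omega (w : word) : set word :=
  closure (range (fun k : nat => iter k shift w)).

Definition is_subshift (Y : set word) : Prop :=
  [/\ closed Y, Y !=set0 & shift @` Y `<=` Y].

(* Density in the subspace Y: the closure relative to Y is all of Y. *)
Definition dense_in (Y A : set word) : Prop := A `<=` Y /\ Y `<=` closure A.

Definition minimal (Y : set word) : Prop :=
  forall y : word, Y y -> dense_in Y (Omega y).

Definition tau_letter (b c : letter) : seq letter :=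
  if c is La then [:: La; b; La] else [:: c].

(* Only b in {Lx, Ly, Lz} is used below. *)
Definition tau (b : letter) (s : seq letter) : seq letter :=
  flatten (map (tau_letter b) s).

Definition beta (k : nat) : letter :=
  match k %% 3 with 1 => Lx | 2 => Ly | _ => Lz end.

(* The sequence l = (l_i) is indexed by i >= 1; the value l 0 is never used.
   p is the pair (N(j), q(j)). *)
Definition is_Nq (l : nat -> nat) (j : nat) (p : nat * nat) : Prop :=
  [/\ 0 < p.1, j = p.2 + \sum_(1 <= i < p.1) l i & p.2 < l p.1].

Definition Nq (l : nat -> nat) (j : nat) : nat * nat := get (is_Nq l j).

(* The big operator folds to the right, so its factors are composed in the
   order i = 1, 2, ..., N - 1 from the outside in. *)
Definition tau_comp (l : nat -> nat) (N q : nat) : seq letter -> seq letter :=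
  (\big[(fun f g => f \o g)/id]_(1 <= i < N) iter (l i) (tau (beta i)))
  \o iter q (tau (beta N)).

Definition tau_iter (l : nat -> nat) (j : nat) : seq letter -> seq letter :=
  tau_comp l (Nq l j).1 (Nq l j).2.

Definition is_prefix (s : seq letter) (w : word) : Prop :=
  mkseq w (size s) = s.

Definition is_eta (l : nat -> nat) (w : word) : Prop :=
  forall j : nat, is_prefix (tau_iter l j [:: La]) w.

(* When the l_i are positive, [get] picks the unique witness, here and in [Nq]:
   see [Nq_unique] and [eta_unique]. *)
Definition eta (l : nat -> nat) : word := get (is_eta l).

Lemma shift_continuous : continuous shift.
Proof.
move=> w; apply/cvg_sup => [|i U [V [[B oB <-] Bw] BU]].
  exact/fmap_filter/nbhs_filter.
apply: (@filterS _ (nbhs w) _ (shift @^-1` _) _ (fun v => BU (shift v))).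
have pc := @proj_continuous nat (fun=> discrete_topology letter) i.+1 w.
exact/pc/open_nbhs_nbhs.
Qed.

Lemma Omega_subshift (w : word) : is_subshift (Omega w).
Proof.
split; first exact: closed_closure.
  by exists w; apply: subset_closure; exists 0.
move=> _ [v wv <-] B /shift_continuous /wv [_ [[k _ <-] Bk]].
by exists (iter k.+1 shift w); split=> //; exists k.+1.
Qed.

Section positive_sequence.
Variable l : nat -> nat.
Hypothesis l_gt0 : forall i, 0 < i -> 0 < l i.

Lemma is_Nq0 : is_Nq l 0 (1, 0).
Proof. by split=> //=; [rewrite big_geq | exact: l_gt0]. Qed.

Lemma is_NqS j N q : is_Nq l j (N, q) ->
  is_Nq l j.+1 (if q.+1 < l N then (N, q.+1) else (N.+1, 0)).
Proof.
move=> [/= N0 jE qN]; case: ltnP => h; split=> //=; first by lia.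
  by rewrite big_nat_recr //= jE; lia.
exact: l_gt0.
Qed.

Lemma Nq_unique j : exists! p, is_Nq l j p.
Proof.
have [p pP] : exists p, is_Nq l j p.
  elim: j => [|j [[N q] /is_NqS]]; first by exists (1, 0); exact: is_Nq0.
  by eexists; eassumption.
exists p; split=> // p' p'P.
have aux r r' : is_Nq l j r -> is_Nq l j r' -> r'.1 <= r.1.
  move=> [r0 rE rl] [r'0 r'E r'l]; rewrite leqNgt; apply/negP => lt.
  have : \sum_(1 <= i < r'.1) l i >= \sum_(1 <= i < r.1.+1) l i.
    by rewrite (@big_cat_nat _ _ _ r.1.+1 1 r'.1) //= leq_addr.
  by rewrite big_nat_recr //=; lia.
have e : p.1 = p'.1 by apply/eqP; rewrite eqn_leq !aux.
case: p pP p'P e {aux} => N q [_ /= jE _] [_ jE' _].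
by case: p' jE' => N' q' /= jE' e; subst N'; congr pair; lia.
Qed.

Lemma NqP j : is_Nq l j (Nq l j).
Proof. by apply: getPex; have [p []] := Nq_unique j; exists p. Qed.

Lemma NqE j p : is_Nq l j p -> Nq l j = p.
Proof. by move=> pP; have [r [_ ru]] := Nq_unique j; rewrite -(ru _ pP) (ru _ (NqP j)). Qed.

Lemma tau_cat b s t : tau b (s ++ t) = tau b s ++ tau b t.
Proof. by rewrite /tau map_cat flatten_cat. Qed.

Lemma tau_comp_cat N q s t :
  tau_comp l N q (s ++ t) = tau_comp l N q s ++ tau_comp l N q t.
Proof.
have it b n u v : iter n (tau b) (u ++ v) = iter n (tau b) u ++ iter n (tau b) v.
  by elim: n => //= n ->; rewrite tau_cat.
rewrite /tau_comp /= it; move: (iter _ _ s) (iter _ _ t).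
elim/big_rec: _ => //= i f _ IH u v.
by rewrite IH it.
Qed.

Lemma tau_comp_gt0 N q s : s != [::] -> tau_comp l N q s != [::].
Proof.
have it b n u : u != [::] -> iter n (tau b) u != [::].
  by move=> u0; elim: n => //= n; case: (iter _ _ _) => // -[].
move=> /(it (beta N) q); rewrite /tau_comp /=; move: (iter _ _ s).
by elim/big_rec: _ => //= i f _ IH u /IH/it.
Qed.

Lemma tau_compS N q s : tau_comp l N q.+1 s = tau_comp l N q (tau (beta N) s).
Proof. by rewrite /tau_comp /= -iterSr. Qed.

Lemma tau_comp_next N : 0 < N -> tau_comp l N.+1 0 =1 tau_comp l N (l N).
Proof.
case: N => // N _ s; rewrite /tau_comp /index_iota !subSS !subn0.
rewrite (_ : iota 1 N.+1 = iota 1 N ++ [:: N.+1]);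
  last by have := iotaD 1 N 1; rewrite addn1 add1n.
rewrite /=; move: (iota 1 N) => r.
elim: r => [|i r IH]; first by rewrite big_cons !big_nil.
by rewrite /= !big_cons /= IH.
Qed.

Lemma tau_iterS j : exists2 b, b != La &
  forall s, tau_iter l j.+1 s = tau_iter l j (tau b s).
Proof.
have := NqP j; rewrite /tau_iter; case: (Nq l j) => N q Nqj.
have [/= N0 _ qN] := Nqj.
exists (beta N); first by rewrite /beta; case: (N %% 3) => [|[|[]]].
move=> s; rewrite (NqE (is_NqS Nqj)) -tau_compS.
case: ltnP => //= h; rewrite tau_comp_next //.
by rewrite (_ : l N = q.+1) //; lia.
Qed.

Lemma tau_iter_cat j s t : tau_iter l j (s ++ t) = tau_iter l j s ++ tau_iter l j t.
Proof. exact: tau_comp_cat. Qed.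

Lemma tau_iterS_a j : exists2 b, b != La &
  tau_iter l j.+1 [:: La]
  = tau_iter l j [:: La] ++ tau_iter l j [:: b] ++ tau_iter l j [:: La].
Proof.
have [b bLa e] := tau_iterS j; exists b => //.
by rewrite e -!tau_iter_cat.
Qed.

Lemma size_tau_iter j : j < size (tau_iter l j [:: La]).
Proof.
have gt0 i : 0 < size (tau_iter l i [:: La]).
  by rewrite lt0n size_eq0 tau_comp_gt0.
elim: j => // j IH; have [b _ ->] := tau_iterS_a j.
by rewrite !size_cat; have := gt0 j; lia.
Qed.

Lemma eta_unique : exists! w, is_eta l w.
Proof.
pose T j := tau_iter l j [:: La].
have pre i j : i <= j -> exists u, T j = T i ++ u.
  move=> /subnK <-; elim: (j - i) => [|k [u e]]; first by exists [::]; rewrite cats0.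
  by rewrite addSn {1}/T; have [b _ ->] := tau_iterS_a (k + i);
    rewrite -/(T _) e -catA; eexists.
exists (fun n => nth La (T n) n); split.
  move=> j; apply: (@eq_from_nth _ La); rewrite size_mkseq // => i ij.
  rewrite nth_mkseq // -/(T j); have iT := size_tau_iter i.
  have [/pre [u ->]|/ltnW /pre [u e]] := leqP i j; first by rewrite nth_cat iT.
  by rewrite e nth_cat ij.
move=> w wP; apply/funext => n; rewrite -[in LHS]/(T n).
by rewrite /T -(wP n) nth_mkseq // size_tau_iter.
Qed.

Lemma etaP : is_eta l (eta l).
Proof. by apply: getPex; have [w []] := eta_unique; exists w. Qed.

End positive_sequence.

(* Main.v *)
Require Import Defs.
From mathcomp Require Import all_boot.
From mathcomp Require Import boolp classical_sets topology.
From mathcomp Require Import zify.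

(** A word is uniformly recurrent if each of its prefixes reoccurs with bounded
    gaps, and this makes its orbit closure minimal: a point [y] of the orbit
    closure of [w] has all its finite prefixes among the factors of [w]
    ([OmegaP]), so a long enough prefix of [y] is a long window of [w] and
    contains any given prefix of [w].  Hence [w] lies in the orbit closure of
    [y], and the two orbit closures coincide ([uniformly_recurrent_minimal]).

    The word [eta l] is uniformly recurrent because its prefixes
    T_j = tau^(j)(a), of unbounded length, satisfy T_(j+1) = T_j b T_j for a
    single letter b, as the substitutions fix every letter other than a.
    Unfolding this recursion down from T_m to T_j writes T_m as copies of T_j
    separated by single letters; these copies start every |T_j| + 1 places,
    which bounds the gaps ([prefix_tau_iter_recurs]). *)

Set Implicit Arguments.
Unset Strict Implicit.
Unset Printing Implicit Defensive.

Local Open Scope classical_set_scope.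

Lemma iter_shiftE (w : word) k i : iter k shift w i = w (k + i).
Proof. by elim: k i => // k IH i; rewrite iterS /shift IH addSnnS. Qed.

Definition agree n (u v : word) : Prop := forall i, i < n -> u i = v i.

Lemma nbhs_agree n (y : word) : nbhs y (agree n y).
Proof.
elim: n => [|n IH]; first exact: (@filterS _ _ _ setT) filterT.
have pc := @proj_continuous nat (fun=> discrete_topology letter) n y.
have yn : nbhs y [set v : word | v n = y n].
  apply: (pc [set c | c = y n]).
  by rewrite -[nbhs _]/(principal_filter _); apply/principal_filterP.
apply: filterS (filterI IH yn) => v [vlt vn] i.
by rewrite ltnS leq_eqVlt => /predU1P[->|/vlt].
Qed.

Lemma agree_cvg (u : nat -> word) (y : word) :
  (forall n, agree n y (u n)) -> u @ \oo --> y.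
Proof.
move=> uy; apply/cvg_sup => i U [V [[B oB <-] By] BU].
exists i.+1 => // n /= ltin; apply: BU.
by rewrite /= -(uy n i).
Qed.

(** Cylinders [agree n y] are a neighbourhood basis of [y], so membership in an
    orbit closure is a question about finite factors. *)
Lemma OmegaP (w y : word) :
  Omega w y <-> forall n, exists k, agree n y (iter k shift w).
Proof.
split=> [wy n|/choice[k ky]].
  by have [_ [[k _ <-] yk]] := wy _ (nbhs_agree n y); exists k.
have orbit_closed := @closed_closure word (range (fun k => iter k shift w)).
apply: (closed_cvg _ orbit_closed _ y (agree_cvg ky)).
by apply: nearW => n; apply: subset_closure; exists (k n).
Qed.

Lemma Omega_trans (w y v : word) : Omega w y -> Omega y v -> Omega w v.
Proof.
move=> /OmegaP wy /OmegaP yv; apply/OmegaP => n.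
have [k vk] := yv n; have [k' yk'] := wy (k + n).
exists (k' + k) => i ltin.
by rewrite vk // iter_shiftE yk' ?ltn_add2l // !iter_shiftE addnA.
Qed.

Definition uniformly_recurrent (w : word) : Prop :=
  forall n, exists r, forall k, exists2 i, i <= r &
    agree n w (iter (k + i) shift w).

Lemma uniformly_recurrent_minimal (w : word) :
  uniformly_recurrent w -> minimal (Omega w).
Proof.
move=> rec_w y wy; have yw : Omega y w.
  apply/OmegaP => n; have [r rP] := rec_w n.
  (* a window of length r + n of w contains a prefix of length n of w *)
  have /OmegaP/(_ (r + n))[k yk] := wy; have [i ler wi] := rP k.
  exists i => h lthn; rewrite iter_shiftE yk; last by lia.
  by rewrite wi // !iter_shiftE addnA.
split=> v; first exact: Omega_trans wy.
by move=> wv; apply: subset_closure; exact: Omega_trans yw wv.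
Qed.

Lemma is_prefix_cat s t (w : word) :
  is_prefix (s ++ t) w -> is_prefix s w /\ is_prefix t (iter (size s) shift w).
Proof.
rewrite /is_prefix size_cat /mkseq iotaD map_cat add0n.
rewrite -[X in iota X (size t)]addn0 iotaDl -map_comp => /eqP.
rewrite eqseq_cat ?size_map ?size_iota // => /andP[/eqP-> /eqP e].
by split=> //; rewrite -[RHS]e; apply: eq_map => i /=; rewrite iter_shiftE.
Qed.

Lemma is_prefix_agree s (u v : word) :
  is_prefix s u -> is_prefix s v -> agree (size s) u v.
Proof.
move=> su sv i lti.
by rewrite -(nth_mkseq La u lti) -(nth_mkseq La v lti) su sv.
Qed.

Lemma tau_iter_letter l j b : b != La -> tau_iter l j [:: b] = [:: b].
Proof.
move=> bLa; have fix_tau c n : iter n (tau c) [:: b] = [:: b].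
  by elim: n => //= n ->; case: b bLa.
rewrite /tau_iter /tau_comp /= fix_tau.
by elim/big_rec: _ => //= i f _ ->.
Qed.

Section Recurrence.
Variable l : nat -> nat.
Hypothesis l_gt0 : forall i, 0 < i -> 0 < l i.

Let T j := tau_iter l j [:: La].

Lemma prefix_tau_iterS m (w : word) : is_prefix (T m.+1) w ->
  is_prefix (T m) w /\ is_prefix (T m) (iter (size (T m)).+1 shift w).
Proof.
rewrite /T; have [b bLa ->] := tau_iterS_a l_gt0 m.
rewrite tau_iter_letter // catA => wT; have [/is_prefix_cat[Tw _]] := is_prefix_cat wT.
by rewrite size_cat addn1.
Qed.

Lemma size_tau_iterS m : size (T m.+1) = (size (T m) + size (T m)).+1.
Proof.
rewrite /T; have [b bLa ->] := tau_iterS_a l_gt0 m.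
by rewrite tau_iter_letter // !size_cat addnS.
Qed.

Lemma prefix_tau_iter_le j d (w : word) :
  is_prefix (T (d + j)) w -> is_prefix (T j) w.
Proof. by elim: d => // d IH /prefix_tau_iterS[/IH]. Qed.

(** In T_m b T_m the windows that fit in either copy are handled by induction
    on m; a window that reaches past the first copy is followed, within |T_j|
    places, by the start of the second one, of which T_j is a prefix. *)
Lemma prefix_tau_iter_recurs j d (w : word) k :
  is_prefix (T (d + j)) w -> k + size (T j) <= size (T (d + j)) ->
  exists2 i, i <= size (T j) & is_prefix (T j) (iter (k + i) shift w).
Proof.
elim: d w k => [|d IH] w k.
  rewrite add0n -[X in _ <= X]add0n leq_add2r leqn0 => wT /eqP->.
  by exists 0.
rewrite addSn size_tau_iterS => /prefix_tau_iterS[wT wT'] le.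
have [|gt] := leqP (k + size (T j)) (size (T (d + j))); first exact: IH.
have [lek|ltk] := leqP k (size (T (d + j))).+1.
  exists ((size (T (d + j))).+1 - k); first by lia.
  by rewrite subnKC //; exact: prefix_tau_iter_le wT'.
have [|i lei] := IH _ (k - (size (T (d + j))).+1) wT'; first by lia.
by rewrite -iterD addnAC subnK 1?ltnW // => Ti; exists i.
Qed.

Lemma eta_uniformly_recurrent : uniformly_recurrent (eta l).
Proof.
move=> n; exists (size (T n)) => k.
(* d is chosen so that T_(d + n) extends past position k + |T_n| *)
pose d := k + size (T n); have wT j := etaP l_gt0 j.
have [|i lei Ti] := @prefix_tau_iter_recurs n d (eta l) k (wT _).
  by have := size_tau_iter l_gt0 (d + n); rewrite -/(T _) /d; lia.
exists i => // h lthn; apply: (is_prefix_agree (wT n) Ti).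
exact: ltn_trans (size_tau_iter l_gt0 n).
Qed.

End Recurrence.

Theorem proposition4p4 (l : nat -> nat) (l_gt0 : forall i : nat, 0 < i -> 0 < l i) :
  minimal (Omega (eta l)).
Proof. exact: uniformly_recurrent_minimal (eta_uniformly_recurrent l_gt0). Qed.
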